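(* Given a dataset $X$ of $N$ samples and a relation matrix $G$ on these samples with degree matrix $D=cI$, the Laplacian Eigenmaps solution $Z^*_{\rm LE}$ for $G$ minimizes the VICReg loss under the constraint that the variance and covariance losses are $0$ (so that the hyper-parameters $\alpha,\beta$ become irrelevant), as in $$\mathcal L_{\rm vic}(Z^*_{\rm LE})=\min_{Z\in\mathbb R^{N\times K}}\mathcal L_{\rm inv}(Z)\quad\text{s.t.}\quad \mathcal L_{\rm var}=0\ \text{ and }\ \mathcal L_{\rm cov}=0 .$$
   Context: The relation matrix $G\in\{0,1\}^{N\times N}$ is symmetric with zero diagonal, with $(G)_{i,j}=1$ iff samples $i$ and $j$ are known to be semantically related. Its degree matrix $D$ is diagonal with $(D)_{i,i}=\sum_j(G)_{i,j}$; $c>0$ is a constant. For a representation $Z\in\mathbb R^{N\times K}$ with rows $Z_{i,\cdot}$, $\mathrm{Cov}(Z)=\frac1N Z^T(I-\frac1N\mathbf 1\mathbf 1^T)Z$ is the empirical covariance matrix. The VICReg loss is $\mathcal L_{\rm vic}=\mathcal L_{\rm var}+\mathcal L_{\rm cov}+\mathcal L_{\rm inv}$ with hyper-parameters $\alpha,\beta,\gamma$ and $\mathcal L_{\rm var}(Z)=\alpha\sum_{k=1}^K\max\big(0,1-\sqrt{\mathrm{Cov}(Z)_{k,k}}\big)$ (variance loss), $\mathcal L_{\rm cov}(Z)=\beta\sum_{k=1}^K\sum_{j\neq k}\mathrm{Cov}(Z)_{k,j}^2$ (covariance loss), $\mathcal L_{\rm inv}(Z)=\frac{\gamma}{N}\sum_{i=1}^N\sum_{j=1}^N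 (G)_{i,j}\|Z_{i,\cdot}-Z_{j,\cdot}\|_2^2$ (invariance loss). Laplacian Eigenmaps (LE) is the problem $\min_Z \mathrm{Tr}(Z^T(D-G)Z)$ subject to $Z^TDZ=I$. Its solution $Z^*_{\rm LE}\in\mathbb R^{N\times K}$ is obtained by taking the eigenvectors of $I-D^{-1}G$ associated with the $K$ smallest eigenvalues, after disregarding the (constant) eigenvector associated with the eigenvalue $0$.
   Formalization: The Laplacian Eigenmaps solution, normalized by Z^T D Z = I, is rescaled by √(cN) to unit variance, since unscaled its variance loss is not 0; the hyper-parameters are assumed to satisfy α ≠ 0, β ≠ 0 and γ ≥ 0. *)

(* Defs.v *)
From HB Require Import structures.
From mathcomp Require Import all_boot all_order all_algebra.
From mathcomp Require Import reals.

Set Implicit Arguments.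
Unset Strict Implicit.
Unset Printing Implicit Defensive.

Import Order.TTheory GRing.Theory Num.Theory.
Local Open Scope ring_scope.

Definition relation_mx (R : realType) (N : nat) (G : 'M[R]_N) : Prop :=
  [/\ forall i j, G i j = 0 \/ G i j = 1,
      G^T = G
    & forall i, G i i = 0].

Definition degree_mx (R : realType) (N : nat) (G : 'M[R]_N) : 'M[R]_N :=
  diag_mx (\row_i \sum_j G i j).

(* [const_mx 1 : 'M_N] is the all-ones matrix 1 1^T. *)
Definition Cov (R : realType) (N K : nat) (Z : 'M[R]_(N, K)) : 'M[R]_K :=
  N%:R^-1 *: (Z^T *m (1%:M - N%:R^-1 *: const_mx 1) *m Z).

(* The squared Euclidean norm; the norm the library puts on matrices is the
   sup norm. *)
Definition sqnorm2 (R : realType) (K : nat) (v : 'rV[R]_K) : R :=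
  \sum_k v 0 k ^+ 2.

Definition loss_var (R : realType) (N K : nat) (alpha : R)
    (Z : 'M[R]_(N, K)) : R :=
  alpha * \sum_k Num.max 0 (1 - Num.sqrt (Cov Z k k)).

Definition loss_cov (R : realType) (N K : nat) (beta : R)
    (Z : 'M[R]_(N, K)) : R :=
  beta * \sum_k \sum_(j | j != k) Cov Z k j ^+ 2.

Definition loss_inv (R : realType) (N K : nat) (G : 'M[R]_N) (gamma : R)
    (Z : 'M[R]_(N, K)) : R :=
  gamma / N%:R * \sum_i \sum_j G i j * sqnorm2 (row i Z - row j Z).

Definition loss_vic (R : realType) (N K : nat) (G : 'M[R]_N)
    (alpha beta gamma : R) (Z : 'M[R]_(N, K)) : R :=
  loss_var alpha Z + loss_cov beta Z + loss_inv G gamma Z.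

(* [Z] collects the eigenvectors of I - D^-1 G for the K smallest eigenvalues,
   the constant one being disregarded.  The columns of [U] are a full basis of
   eigenvectors, normalized by the constraint U^T D U = I (hence
   Z^T D Z = I), with eigenvalues [lam] listed with multiplicity in
   nondecreasing order; column 0 is the constant eigenvector (of eigenvalue 0)
   and [Z] consists of columns 1, ..., K.  If 0 is a multiple eigenvalue (G is
   disconnected) only the constant eigenvector is dropped. *)
Definition LE_solution (R : realType) (N K : nat) (G : 'M[R]_N)
    (Z : 'M[R]_(N, K)) : Prop :=
  let D := degree_mx G in
  (K < N)%N /\
  exists (U : 'M[R]_N) (lam : 'rV[R]_N),
    [/\ (1%:M - invmx D *m G) *m U = U *m diag_mx lam,
        U^T *m D *m U = 1%:M,
        forall i j : 'I_N, (i <= j)%N -> lam 0 i <= lam 0 j,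
        forall i i' j : 'I_N, j = 0%N :> nat -> U i j = U i' j
      & forall (i : 'I_N) (k : 'I_K) (j : 'I_N),
          j = k.+1 :> nat -> Z i k = U i j].

Definition is_minimizer (R : realType) (T : Type) (f : T -> R)
    (S : T -> Prop) (x : T) : Prop :=
  S x /\ forall y, S y -> f x <= f y.

Definition is_min_value (R : realType) (T : Type) (f : T -> R)
    (S : T -> Prop) (m : R) : Prop :=
  (exists2 x, S x & f x = m) /\ forall y, S y -> m <= f y.

(* Main.v *)
(** Write a representation in the coordinates of the LE eigenbasis, [Z = U A].
    The invariance loss becomes a weighted sum of the squared entries of [A],
    the weight of row [j] being the eigenvalue [lam_j], and the covariance
    becomes the Gram matrix of [A] with row 0 (the constant direction) erased.
    Zero variance and covariance losses say that the columns of this truncated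
    [A] are orthogonal with squared norm at least [N c], and LE is then optimal
    by Ky Fan's inequality: for orthonormal columns the squared row norms [p_j]
    are at most 1 and sum to [K], so the weighted sum of the [p_j] is least
    when the mass sits on the [K] smallest available eigenvalues. *)
Require Import Defs.
From HB Require Import structures.
From mathcomp Require Import all_boot all_order all_algebra.
From mathcomp Require Import reals.
From mathcomp Require Import ring lra.
Import Order.TTheory GRing.Theory Num.Theory.
Local Open Scope ring_scope.

Lemma orthonormal_row_sqnorm_le1 {R : realType} {n K : nat} (Q : 'M[R]_(n, K)) :
  Q^T *m Q = 1%:M -> forall j, \sum_k Q j k ^+ 2 <= 1.
Proof.
move=> QQ j; pose P := Q *m Q^T.
have Pjj : \sum_k Q j k ^+ 2 = P j j.
  by rewrite mxE; apply: eq_bigr => k _; rewrite mxE expr2.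
(* [P] is an orthogonal projection, so [P j j] is the squared norm of its
   row [j], which is at least [P j j ^+ 2]. *)
have PP : P *m P^T = P.
  by rewrite trmx_mul trmxK mulmxA -(mulmxA Q) QQ mulmx1.
have PPj : \sum_i P j i ^+ 2 = P j j.
  rewrite -[in RHS]PP [RHS]mxE; apply: eq_bigr => i _.
  by rewrite [P^T i j]mxE expr2.
have : P j j ^+ 2 <= P j j.
  rewrite -[leRHS]PPj (bigD1 j) //= lerDl.
  by apply: sumr_ge0 => i _; exact: sqr_ge0.
rewrite Pjj; nra.
Qed.

(** The squared row norms [p] and the indicator [e] have the same total mass [K], so shifting [lam]
    by the pivot [m = lam K] leaves the difference of the two sides unchanged. Each term
    [(lam j - m) * (p j - e j)] is then nonnegative: its factors agree in sign on either side of the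
    pivot, and row 0 contributes nothing. *)
Lemma ky_fan_le {R : realType} {n K : nat} (lam : 'I_n.+1 -> R)
    (Q : 'M[R]_(n.+1, K)) :
  (K < n.+1)%N -> {homo lam : i j / (i <= j)%N >-> i <= j} ->
  Q^T *m Q = 1%:M -> (forall k, Q ord0 k = 0) ->
  \sum_(j < n.+1 | (0 < j <= K)%N) lam j <=
    \sum_j lam j * \sum_k Q j k ^+ 2.
Proof.
move=> ltKn lam_homo QQ Q0; pose p j := \sum_k Q j k ^+ 2.
pose m := lam (Ordinal ltKn); pose e (j : 'I_n.+1) : R := (0 < j <= K)%N%:R.
have sum_p : \sum_j p j = K%:R.
  rewrite exchange_big /= -[RHS]mulr1 mulr_natl -[in RHS](card_ord K) -sumr_const.
  apply: eq_bigr => k _.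
  have := congr1 (fun M : 'M[R]_K => M k k) QQ; rewrite !mxE eqxx mulr1n => <-.
  by apply: eq_bigr => j _; rewrite mxE expr2.
have sum_e : \sum_j e j = K%:R.
  rewrite /e -natr_sum; congr _%:R.
  rewrite -(big_mkord xpredT (fun j => nat_of_bool (0 < j <= K)%N)).
  rewrite big_nat_recl // add0n big_mkord /=.
  rewrite -big_mkcond /= -(big_ord_widen n (fun=> 1%N)) //.
  by rewrite sum1_card card_ord.
rewrite -subr_ge0 [X in _ - X]big_mkcond -sumrB.
have -> : \sum_j (lam j * p j - (if (0 < j <= K)%N then lam j else 0)) =
    \sum_j (lam j - m) * (p j - e j).
  transitivity (\sum_j ((lam j - m) * (p j - e j) + m * (p j - e j))).
    by apply: eq_bigr => j _; rewrite /e; case: ifP => _ /=; ring.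
  by rewrite big_split /= -mulr_sumr sumrB sum_p sum_e subrr mulr0 addr0.
apply: sumr_ge0 => j _.
have p_ge0 : 0 <= p j by apply: sumr_ge0 => k _; exact: sqr_ge0.
have p_le1 : p j <= 1 by exact: orthonormal_row_sqnorm_le1.
have [j0 | j_gt0] := posnP j.
  have -> : p j = 0.
    rewrite /p big1 // => k _.
    by rewrite (_ : j = ord0) ?Q0 ?expr0n //; apply: val_inj.
  by rewrite /e j0 subrr mulr0.
rewrite /e j_gt0; have [leKj | ltKj] := leqP j K.
  have : lam j <= m by exact: lam_homo.
  by rewrite /=; nra.
have : m <= lam j by apply: lam_homo; exact: ltnW.
by rewrite /=; nra.
Qed.

(** Expanding the square gives two degree terms, equal by symmetry of [G], and twice a cross term;
    hence the factor 2. *)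
Lemma loss_invE {R : realType} {N K : nat} (G : 'M[R]_N) (gamma : R)
    (Z : 'M[R]_(N, K)) :
  G^T = G ->
  loss_inv G gamma Z =
    gamma / N%:R * (2 * \tr (Z^T *m (degree_mx G - G) *m Z)).
Proof.
move=> Gsym; congr (_ * _).
have Gij i j : G i j = G j i by rewrite -{1}Gsym mxE.
have -> : \tr (Z^T *m (degree_mx G - G) *m Z) =
    \sum_k (\sum_i \sum_j G i j * Z i k ^+ 2 -
            \sum_i \sum_j G i j * (Z i k * Z j k)).
  apply: eq_bigr => k _; rewrite mulmxBr mulmxBl !mxE; congr (_ - _).
    apply: eq_bigr => i _.
    rewrite mul_mx_diag !mxE -mulr_suml; ring.
  rewrite exchange_big /=; apply: eq_bigr => j _.
  rewrite mxE mulr_suml; apply: eq_bigr => i _; rewrite !mxE; ring.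
rewrite mulr_sumr.
transitivity (\sum_k \sum_i \sum_j G i j * (Z i k - Z j k) ^+ 2).
  rewrite [RHS]exchange_big /=; apply: eq_bigr => i _.
  rewrite [RHS]exchange_big /=; apply: eq_bigr => j _.
  by rewrite mulr_sumr; apply: eq_bigr => k _; rewrite !mxE.
apply: eq_bigr => k _.
have swap : \sum_i \sum_j G i j * Z j k ^+ 2 = \sum_i \sum_j G i j * Z i k ^+ 2.
  rewrite exchange_big; apply: eq_bigr => i _.
  by apply: eq_bigr => j _; rewrite Gij.
rewrite mulrBr mulr2n !mulrDl !mul1r opprD -{2}swap -!sumrN -!big_split /=.
apply: eq_bigr => i _; rewrite -!sumrN -!big_split /=.
by apply: eq_bigr => j _; ring.
Qed.

Lemma mul_congr_diagE {R : comNzRingType} {n K : nat} (A : 'M[R]_(n, K))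
    (d : 'rV[R]_n) k l :
  (A^T *m diag_mx d *m A) k l = \sum_j d 0 j * (A j k * A j l).
Proof.
by rewrite mxE; apply: eq_bigr => j _; rewrite mul_mx_diag !mxE; ring.
Qed.

(** Centering kills the constant column 0. The other columns are orthogonal to it, so they have zero
    sum and centering fixes them. *)
Lemma centering_coords {R : realType} {n : nat} (c : R) (U : 'M[R]_n.+1) :
  0 < c -> U^T *m c%:M *m U = 1%:M -> (forall i i', U i ord0 = U i' ord0) ->
  U^T *m (1%:M - n.+1%:R^-1 *: const_mx 1) *m U =
    diag_mx (\row_j (c^-1 * (j != ord0)%:R)).
Proof.
move=> c_gt0 UU Uconst; have c_neq0 : c != 0 by rewrite gt_eqF.
have UTU : U^T *m U = c^-1%:M.
  apply: (scalerI c_neq0); rewrite scale_scalar_mx divff //.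
  by rewrite -UU mul_mx_scalar scalemxAl.
(* This is entry [(j, 0)] of [U^T *m U], column 0 being constant. *)
have col_sum j : \sum_i U i j * U ord0 ord0 = c^-1 * (j == ord0)%:R.
  have := congr1 (fun M : 'M[R]_n.+1 => M j ord0) UTU; rewrite !mxE mulr_natr => <-.
  by apply: eq_bigr => i _; rewrite mxE (Uconst i ord0).
set a := U ord0 ord0 in col_sum.
have a2 : a ^+ 2 = (c * n.+1%:R)^-1.
  have := col_sum ord0; rewrite eqxx mulr1.
  rewrite (eq_bigr (fun=> a ^+ 2)); last by move=> i _; rewrite (Uconst i ord0) expr2.
  rewrite sumr_const card_ord -[_ *+ _]mulr_natr invfM => <-.
  by rewrite mulfK // pnatr_eq0.
have a_neq0 : a != 0.
  by rewrite -sqrf_eq0 a2 invr_eq0 mulf_neq0 // pnatr_eq0.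
have sumU j : \sum_i U i j = (c * a)^-1 * (j == ord0)%:R.
  apply: (mulIf a_neq0); rewrite mulr_suml col_sum invfM mulrAC -!mulrA.
  by rewrite mulKf.
rewrite mulmxBr mulmxBl mulmx1 UTU; apply/matrixP => i j.
rewrite -scalemxAr -scalemxAl !mxE.
have -> : \sum_l (U^T *m const_mx 1) i l * U l j =
    (\sum_l U l i) * (\sum_l U l j).
  rewrite mulr_sumr; apply: eq_bigr => l _; congr (_ * _).
  by rewrite mxE; apply: eq_bigr => l' _; rewrite !mxE mulr1.
rewrite !sumU.
have [-> | ij] := eqVneq i j; last first.
  have [i0 | _] := eqVneq i ord0; last by rewrite !(mulr0, mul0r, mulr0n) subrr.
  by rewrite -i0 (negbTE (_ : j != i)) 1?eq_sym // !mulr0 !mulr0n subrr.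
have [_ | _] := eqVneq j ord0; last by rewrite !(mulr0, mulr1n, mulr1) subr0.
have : n.+1%:R != 0 :> R by rewrite pnatr_eq0.
rewrite /= !mulr1 mulr0 !mulr1n -expr2 exprVn exprMn a2.
by move: (n.+1%:R : R) => N1 N1_neq0; field; apply/andP; split.
Qed.

Theorem theorem2 (R : realType) (N K : nat) (G : 'M[R]_N)
    (c alpha beta gamma : R) (Z_LE : 'M[R]_(N, K)) :
  relation_mx G ->
  0 < c ->
  degree_mx G = c%:M ->
  alpha != 0 -> beta != 0 -> 0 <= gamma ->
  LE_solution G Z_LE ->
  (* LE normalizes Z^T D Z = I, i.e. Cov(Z) = (c N)^-1 I; rescale the
     solution to unit variance *)
  let Z_star := Num.sqrt (c * N%:R) *: Z_LE in
  let feasible (Z : 'M[R]_(N, K)) :=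
    loss_var alpha Z = 0 /\ loss_cov beta Z = 0 in
  is_minimizer (loss_vic G alpha beta gamma) feasible Z_star /\
  is_min_value (loss_inv G gamma) feasible
    (loss_vic G alpha beta gamma Z_star).
Proof.
move=> [_ Gsym _] c_gt0 Dc alpha0 beta0 gamma_ge0 [].
case: N G Gsym Dc Z_LE => [|n] G Gsym Dc Z_LE // ltKN [U [lam [LU UU lam_le Uc ZU]]].
move=> Z_star feasible.
have c_neq0 : c != 0 by rewrite gt_eqF.
rewrite Dc in UU LU.
have Uconst i i' : U i ord0 = U i' ord0 by exact: Uc.
set N1 : R := n.+1%:R.
have cN_gt0 : 0 < c * N1 by rewrite mulr_gt0 // ltr0n.
have lapU : U^T *m (degree_mx G - G) *m U = diag_mx lam.
  have -> : degree_mx G - G = c%:M *m (1%:M - invmx c%:M *m G).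
    by rewrite mulmxBr mulmx1 mulKVmx ?Dc // unitmxE det_scalar unitrX ?unitfE.
  by rewrite -!mulmxA LU !mulmxA UU mul1mx.
(* The normalization [UU] makes [U^T *m c%:M] the inverse of [U]. *)
pose A (Z : 'M[R]_(n.+1, K)) := U^T *m c%:M *m Z.
have UA Z : U *m A Z = Z by rewrite mulmxA (mulmx1C UU) mul1mx.
have congrA (M : 'M[R]_n.+1) Z : Z^T *m M *m Z = (A Z)^T *m (U^T *m M *m U) *m A Z.
  by rewrite -{1 2}(UA Z) trmx_mul !mulmxA.
have CovA Z k l :
    Cov Z k l = (c * N1)^-1 * \sum_(j | j != ord0) A Z j k * A Z j l.
  rewrite /Cov congrA (centering_coords c) // mxE mul_congr_diagE.
  rewrite invfM mulrAC [RHS]mulrC; congr (_ * _).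
  rewrite [X in _ = _ * X]big_mkcond mulr_sumr.
  by apply: eq_bigr => j _; rewrite mxE; case: ifP => _ /=; ring.
have invA Z : loss_inv G gamma Z =
    gamma / N1 * (2 * \sum_j lam 0 j * \sum_k A Z j k ^+ 2).
  rewrite loss_invE // congrA lapU; congr (_ * (_ * _)).
  rewrite /mxtrace; under eq_bigr do rewrite mul_congr_diagE.
  rewrite exchange_big; apply: eq_bigr => j _; rewrite mulr_sumr.
  by apply: eq_bigr => k _; rewrite expr2.
(* The eigenvalues are sorted and the first one is 0, because [degree_mx G - G] annihilates constant
   vectors. *)
have lam_ge0 j : 0 <= lam 0 j.
  suff <- : lam 0 ord0 = 0 by exact: lam_le.
  have lapconst : (degree_mx G - G) *m (const_mx 1 : 'cV[R]_n.+1) = 0.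
    apply/matrixP => i j0; rewrite mulmxBl mxE mul_diag_mx !mxE mulr1.
    by apply/eqP; rewrite subr_eq0; apply/eqP/eq_bigr => l _; rewrite mxE mulr1.
  have := congr1 (fun M : 'M[R]_n.+1 => M ord0 ord0) lapU.
  rewrite [diag_mx _ _ _]mxE eqxx mulr1n => <-.
  rewrite -mulmxA [LHS]mxE big1 // => i _.
  suff -> : ((degree_mx G - G) *m U) i ord0 = 0 by rewrite mulr0.
  transitivity (U ord0 ord0 * ((degree_mx G - G) *m (const_mx 1 : 'cV[R]_n.+1)) i 0).
    rewrite !mxE mulr_sumr; apply: eq_bigr => l _.
    by rewrite (Uconst l ord0) [const_mx _ _ _]mxE mulr1 mulrC.
  by rewrite lapconst mxE mulr0.
have feasibleP Z : feasible Z <->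
    (forall k, 1 <= Cov Z k k) /\ (forall k l, l != k -> Cov Z k l = 0).
  split=> [[/eqP vZ /eqP cZ] | [vZ cZ]].
    move: vZ cZ; rewrite /loss_var /loss_cov !mulf_eq0.
    rewrite (negbTE alpha0) (negbTE beta0) /= => vZ cZ; split=> [k | k l lk].
      move: vZ; rewrite psumr_eq0 => [/allP /(_ k)|? _]; last by rewrite le_max lexx.
      rewrite mem_index_enum => /(_ isT) /= /eqP; move/max_idPl; rewrite subr_le0 => sqrt_ge1.
      (* [Num.sqrt] is 0 on negative numbers, so a positive root forces a positive variance. *)
      have Cov_gt0 : 0 < Cov Z k k by rewrite -sqrtr_gt0 (lt_le_trans ltr01).
      by rewrite -(ler_sqrt _ (ltW Cov_gt0)) sqrtr1.
    move: cZ; rewrite psumr_eq0 => [/allP /(_ k)|? _]; last first.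
      by apply: sumr_ge0 => ? _; exact: sqr_ge0.
    rewrite mem_index_enum => /(_ isT) /=.
    rewrite psumr_eq0 => [/allP /(_ l)|? _]; last exact: sqr_ge0.
    by rewrite mem_index_enum lk => /(_ isT) /=; rewrite sqrf_eq0 => /eqP.
  rewrite /feasible /loss_var /loss_cov !big1 ?mulr0 // => k _.
    by rewrite big1 // => l lk; rewrite cZ // expr0n.
  by apply/max_idPl; rewrite subr_le0 -{1}sqrtr1 ler_wsqrtr.
have vic_inv Z : feasible Z -> loss_vic G alpha beta gamma Z = loss_inv G gamma Z.
  by case=> vZ cZ; rewrite /loss_vic vZ cZ !add0r.
(* The index shift reflects the dropped constant column of [U]. *)
have AZ j k : A Z_star j k = Num.sqrt (c * N1) * (j == k.+1 :> nat)%:R.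
  have ltkN : (k.+1 < n.+1)%N by exact: leq_ltn_trans (ltn_ord k) ltKN.
  have : (U^T *m c%:M *m U) j (Ordinal ltkN) = (j == k.+1 :> nat)%:R.
    by rewrite UU mxE.
  rewrite /A -scalemxAr => <-; rewrite [LHS]mxE; congr (_ * _).
  by rewrite [LHS]mxE [RHS]mxE; apply: eq_bigr => i _; rewrite (ZU i k (Ordinal ltkN)).
have star_feasible : feasible Z_star.
  have CovZ k l : Cov Z_star k l = (k == l)%:R.
    have ltkN : (k.+1 < n.+1)%N by exact: leq_ltn_trans (ltn_ord k) ltKN.
    rewrite CovA (bigD1 (Ordinal ltkN)) //= big1 => [|j /andP[_ jk]].
      rewrite !AZ eqxx mulr1 mulrA -expr2 sqr_sqrtr 1?ltW // addr0 mulrA.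
      by rewrite mulVf ?(gt_eqF cN_gt0) // mul1r eqSS.
    by rewrite AZ -[_ == _ :> nat]/(j == Ordinal ltkN) (negbTE jk) mulr0 mul0r.
  apply/feasibleP; split=> [k | k l lk]; first by rewrite CovZ eqxx.
  by rewrite CovZ eq_sym (negbTE lk).
have inv_star : loss_inv G gamma Z_star =
    gamma / N1 * (2 * (c * N1 * \sum_(j < n.+1 | (0 < j <= K)%N) lam 0 j)).
  rewrite invA; congr (_ * (_ * _)).
  rewrite mulr_sumr [RHS]big_mkcond; apply: eq_bigr => j _.
  case: ifP => [/andP[j_gt0 jK] | jF]; last first.
    rewrite big1 ?mulr0 // => k _; rewrite AZ; case: eqP => [jk|]; last by rewrite mulr0 expr0n.
    by rewrite jk /= ltn_ord in jF.
  have ltjK : (j.-1 < K)%N by rewrite prednK.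
  rewrite (bigD1 (Ordinal ltjK)) //= big1 => [|k kj].
    by rewrite AZ /= prednK // eqxx mulr1 sqr_sqrtr 1?ltW // addr0 mulrC.
  rewrite AZ; case: eqP => [jk|]; last by rewrite mulr0 expr0n.
  by case/eqP: kj; apply: val_inj; rewrite /= jk.
have star_min Z : feasible Z -> loss_inv G gamma Z_star <= loss_inv G gamma Z.
  move=> /feasibleP [Cov_ge1 Cov_off]; rewrite inv_star invA.
  apply: ler_wpM2l; first by rewrite divr_ge0.
  apply: ler_wpM2l => //.
  (* By [CovA], [s k] is the norm of column [k] of [A Z] with row 0 erased; dividing by it makes the
     columns of [Q] orthonormal. *)
  pose s k := Num.sqrt (c * N1 * Cov Z k k).
  have s2 k : s k ^+ 2 = c * N1 * Cov Z k k.
    by rewrite sqr_sqrtr // mulr_ge0 // ?(ltW cN_gt0) // (le_trans ler01).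
  have s2_gt0 k : 0 < s k ^+ 2.
    by rewrite s2 mulr_gt0 // (lt_le_trans ltr01).
  have s_neq0 k : s k != 0 by rewrite -sqrf_eq0 gt_eqF.
  pose Q : 'M[R]_(n.+1, K) := \matrix_(j, k) (A Z j k / s k *+ (j != ord0)).
  have QQ : Q^T *m Q = 1%:M.
    apply/matrixP => k l; rewrite !mxE.
    have -> : \sum_j Q^T k j * Q j l = c * N1 * Cov Z k l / (s k * s l).
      rewrite CovA mulVKf ?gt_eqF // mulr_suml [RHS]big_mkcond.
      apply: eq_bigr => j _; rewrite !mxE; case: ifP => _; last by rewrite mulr0.
      by rewrite !mulr1n invfM; ring.
    have [<- | kl] := eqVneq k l; first by rewrite -s2 -expr2 divff // gt_eqF.
    by rewrite Cov_off 1?eq_sym // mulr0 mul0r.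
  have Q0 k : Q ord0 k = 0 by rewrite mxE eqxx.
  have /= ky := ky_fan_le (lam 0) Q ltKN lam_le QQ Q0.
  (* It remains to undo the normalization entrywise: variance at least 1 gives [c * N1 <= s k ^+ 2],
     and restoring row 0 only adds nonnegative terms since [lam] is nonnegative. *)
  apply: le_trans (ler_wpM2l (ltW cN_gt0) ky) _.
  rewrite mulr_sumr; apply: ler_sum => j _; rewrite mulrCA.
  apply: ler_wpM2l => //; rewrite mulr_sumr; apply: ler_sum => k _.
  rewrite mxE; case: (j != ord0); last by rewrite mulr0n expr0n mulr0 sqr_ge0.
  rewrite mulr1n exprMn exprVn mulrCA ler_piMr ?sqr_ge0 //.
  by rewrite ler_pdivrMr // mul1r s2 ler_peMr // ltW.
split; split.
- exact: star_feasible.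
- by move=> Z fZ; rewrite !vic_inv //; exact: star_min.
- by exists Z_star => //; rewrite vic_inv.
- by move=> Z fZ; rewrite vic_inv //; exact: star_min.
Qed.
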